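(* Let $S$ and $T$ be semigroups with weak local units. If $T\cong\Sigma^\beta$ for some dual pair $\beta=({}_SA,B_S)$ over $S$, then $S$ and $T$ are strongly Morita equivalent.
   Context: Acts: a left $S$-act ${}_SA$ is a set $A$ with a map $S\times A\to A$ satisfying $(st)a=s(ta)$; right acts are defined dually. An $(S,T)$-biact is a left $S$-act and right $T$-act with $(sa)t=s(at)$. Morphisms are maps preserving the actions; $\mathrm{End}({}_SA)$ and $\mathrm{End}(B_S)$ denote the monoids of act endomorphisms. A biact ${}_SA_T$ is unitary if $SA=A=AT$. For a right $S$-act $A_S$ and a left $S$-act ${}_SB$, the tensor product $A\otimes_S B$ is the quotient of the set $A\times B$ by the smallest equivalence relation identifying $(as,b)$ with $(a,sb)$ for all $a\in A$, $s\in S$, $b\in B$. A semigroup $S$ has weak local units if for every $s\in S$ there exist $u,v\in S$ such that $us=s=sv$. A Morita context connecting semigroups $S$ and $T$ is a six-tuple $(S,T,{}_SP_T,{}_TQ_S,\theta,\phi)$, where ${}_SP_T$ is an $(S,T)$-biact, ${}_TQ_S$ is a $(T,S)$-biact, and $\theta:{}_S(P\otimes_T Q)_S\to{}_SS_S$ and $\phi:{}_T(Q\otimes_S P)_T\to{}_TT_T$ are biact morphisms such that $\theta(p\otimes q)p'=p\,\phi(q\otimes p')$ and $q'\theta(p\otimes q)=\phi(q'\otimes p)q$ for all $p,p'\in P$, $q,q'\in Q$. It is unitary if both biacts are unitary and surjective if $\theta$ and $\phi$ are surjective. Semigroups are strongly Morita equivalent if they are connected by a unitary surjective Morita context. A pair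 $\beta=({}_SA,B_S)$ over $S$ consists of a left act ${}_SA$, a right act $B_S$ and an $(S,S)$-biact morphism $\langle\,,\rangle:{}_SA\times B_S\to{}_SS_S$, i.e. $\langle sa,b\rangle=s\langle a,b\rangle$ and $\langle a,bs\rangle=\langle a,b\rangle s$. The pair is dual if (1) for every $a\in A$ there exists $a'\in A$ with $a\in Sa'$ and $\langle a',B\rangle=S$; and (2) for every $b\in B$ there exists $b'\in B$ with $b\in b'S$ and $\langle A,b'\rangle=S$. Define $$\Omega^\beta=\{(\rho,\sigma)\mid\rho\in\mathrm{End}({}_SA),\ \sigma\in\mathrm{End}(B_S),\ \langle\rho(a),b\rangle=\langle a,\sigma(b)\rangle\text{ for all }a\in A,\ b\in B\},$$ with multiplication $(f,g)(f',g')=(f'f,gg')$, where $f'f$ is the composite $x\mapsto f'(f(x))$ and $gg'$ the composite $y\mapsto g(g'(y))$, and $$\Sigma^\beta=\{(\rho,\sigma)\in\Omega^\beta\mid\exists b\in B,\ \exists a\in A:\ \rho=\langle -,b\rangle a\text{ and }\sigma=b\langle a,-\rangle\},$$ which is a subsemigroup of $\Omega^\beta$. *)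

(* Defs.v *)
From HB Require Import structures.
From Stdlib Require Import Relation_Operators.
From mathcomp Require Import all_boot.
From mathcomp Require Import boolp.

Set Implicit Arguments.
Unset Strict Implicit.
Unset Printing Implicit Defensive.

Declare Scope act_scope.
Delimit Scope act_scope with act.
Local Open Scope group_scope.
Local Open Scope quotient_scope.
Local Open Scope act_scope.

Definition weak_local_units (S : semigroupType) : Prop :=
  forall s : S, exists u v : S, u * s = s /\ s * v = s.

Definition semigroup_isomorphic (S T : semigroupType) : Prop :=
  exists f : {multiplicative S -> T}, bijective f.

(* Carriers are [choiceType]s, as for [semigroupType]; by [gen_choiceMixin]
   every type has such a structure. *)
Record leftAct (S : semigroupType) := LeftAct {
  lact_sort :> choiceType;
  lact : S -> lact_sort -> lact_sort;
  lactA : forall s t a, lact (s * t) a = lact s (lact t a) }.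

Record rightAct (S : semigroupType) := RightAct {
  ract_sort :> choiceType;
  ract : ract_sort -> S -> ract_sort;
  ractA : forall a s t, ract a (s * t) = ract (ract a s) t }.

Arguments LeftAct {S lact_sort} lact lactA.
Arguments RightAct {S ract_sort} ract ractA.
Notation "s *> a" := (lact s a) (at level 40, left associativity) : act_scope.
Notation "a <* s" := (ract a s) (at level 40, left associativity) : act_scope.

Record biact (S T : semigroupType) := Biact {
  biact_left :> leftAct S;
  biact_ract : biact_left -> T -> biact_left;
  biact_ractA :
    forall a s t, biact_ract a (s * t) = biact_ract (biact_ract a s) t;
  biact_assoc : forall s a t, biact_ract (s *> a) t = s *> biact_ract a t }.

Coercion biact_right S T (X : biact S T) : rightAct T :=
  RightAct (@biact_ract S T X) (@biact_ractA S T X).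
(* Lets [y <* t] elaborate when [y] lies in (the left part of) a biact. *)
Canonical biact_right.

Definition left_morph S (A B : leftAct S) (f : A -> B) : Prop :=
  forall s a, f (s *> a) = s *> f a.

Definition right_morph S (A B : rightAct S) (f : A -> B) : Prop :=
  forall a s, f (a <* s) = f a <* s.

Definition biact_morph S T (X Y : biact S T) (f : X -> Y) : Prop :=
  left_morph f /\ right_morph (A := X) (B := Y) f.

Definition unitary S T (X : biact S T) : Prop :=
  (forall x : X, exists (s : S) (y : X), x = s *> y) /\
  (forall x : X, exists (y : X) (t : T), x = y <* t).

Section RegularBiact.
Variable S : semigroupType.

Lemma regular_lactA (s t a : S) : (s * t) * a = s * (t * a).
Proof. by rewrite mulgA. Qed.

Lemma regular_ractA (a s t : S) : a * (s * t) = (a * s) * t.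
Proof. by rewrite mulgA. Qed.

Definition regular_biact : biact S S :=
  @Biact S S (LeftAct _ regular_lactA) _ regular_ractA
    (fun s a t => esym (mulgA s a t)).

End RegularBiact.

Section Tensor.
Variables (S : semigroupType) (A : rightAct S) (B : leftAct S).

Inductive tensor_step : A * B -> A * B -> Prop :=
  TensorStep a s b : tensor_step (a <* s, b) (a, s *> b).

(* The smallest equivalence relation containing [tensor_step]. *)
Definition tensor_rel : rel (A * B) :=
  fun x y => `[< clos_refl_sym_trans _ tensor_step x y >].

Lemma tensor_rel_equiv : equiv_class_of tensor_rel.
Proof.
split.
- by move=> x; apply/asboolP; apply: rst_refl.
- by move=> x y; apply/asboolP/asboolP; apply: rst_sym.
- move=> y x z /asboolP xy /asboolP yz.
  by apply/asboolP; apply: rst_trans yz.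
Qed.

Canonical tensor_equiv := EquivRelPack tensor_rel_equiv.

Definition tensor : choiceType := {eq_quot tensor_equiv}.

Definition tens (a : A) (b : B) : tensor := \pi_({eq_quot tensor_equiv}) (a, b).

Lemma tens_balanced a s b : tens (a <* s) b = tens a (s *> b).
Proof. by apply/eqmodP/asboolP/rst_step; constructor. Qed.

Lemma tens_surj (x : tensor) : exists a b, x = tens a b.
Proof.
exists (repr (x : {eq_quot tensor_equiv})).1.
exists (repr (x : {eq_quot tensor_equiv})).2.
by rewrite /tens -surjective_pairing reprK.
Qed.

(* Evaluates f at a chosen representative; see [tensor_liftE] for balanced f. *)
Definition tensor_lift (C : Type) (f : A -> B -> C) (x : tensor) : C :=
  let p := repr (x : {eq_quot tensor_equiv}) in f p.1 p.2.

Lemma tensor_liftE (C : Type) (f : A -> B -> C) :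
  (forall a s b, f (a <* s) b = f a (s *> b)) ->
  forall a b, tensor_lift f (tens a b) = f a b.
Proof.
move=> fP a b; rewrite /tensor_lift /=.
have : tensor_rel (repr (\pi_({eq_quot tensor_equiv}) (a, b))) (a, b).
  by apply/eqmodP; rewrite reprK.
move: (repr _) => p /asboolP rel_p.
suff H x y : clos_refl_sym_trans _ tensor_step x y -> f x.1 x.2 = f y.1 y.2.
  exact: (H _ _ rel_p).
elim=> {x y} [x y [a' s b']|x|x y _ ->|x y z _ -> _ ->] //=.
Qed.

End Tensor.

Notation "a ⊗ b" := (tens a b) (at level 40, left associativity) : act_scope.

Section TensorBiact.
Variables (S T U : semigroupType) (P : biact S T) (Q : biact T U).
Local Notation PQ := (tensor P Q).

Definition tensor_lact (s : S) : PQ -> PQ :=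
  tensor_lift (A := P) (B := Q) (fun p q => tens (A := P) (s *> p) q).

Definition tensor_ract (x : PQ) (u : U) : PQ :=
  tensor_lift (A := P) (B := Q) (fun p q => tens (A := P) p (q <* u)) x.

Lemma tensor_lactE s (p : P) (q : Q) :
  tensor_lact s (tens (A := P) p q) = tens (A := P) (s *> p) q.
Proof.
apply: tensor_liftE => a t b; rewrite -tens_balanced; congr tens.
by rewrite /= biact_assoc.
Qed.

Lemma tensor_ractE (p : P) (q : Q) u :
  tensor_ract (tens (A := P) p q) u = tens (A := P) p (q <* u).
Proof.
rewrite /tensor_ract tensor_liftE // => a t b.
by rewrite tens_balanced /= biact_assoc.
Qed.

Lemma tensor_lactA s t x :
  tensor_lact (s * t) x = tensor_lact s (tensor_lact t x).
Proof. by have [p [q ->]] := tens_surj x; rewrite !tensor_lactE lactA. Qed.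

Lemma tensor_ractA x s t :
  tensor_ract x (s * t) = tensor_ract (tensor_ract x s) t.
Proof. by have [p [q ->]] := tens_surj x; rewrite !tensor_ractE ractA. Qed.

Lemma tensor_assoc s x u :
  tensor_ract (tensor_lact s x) u = tensor_lact s (tensor_ract x u).
Proof.
have [p [q ->]] := tens_surj x.
by rewrite tensor_ractE !tensor_lactE tensor_ractE.
Qed.

Definition tensor_biact : biact S U :=
  @Biact S U (LeftAct _ tensor_lactA) _ tensor_ractA tensor_assoc.

End TensorBiact.

Record moritaContext (S T : semigroupType) := MoritaContext {
  mcP : biact S T;
  mcQ : biact T S;
  mc_theta : tensor_biact mcP mcQ -> regular_biact S;
  mc_phi : tensor_biact mcQ mcP -> regular_biact T;
  mc_theta_morph : biact_morph mc_theta;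
  mc_phi_morph : biact_morph mc_phi;
  mc_thetaA : forall (p p' : mcP) (q : mcQ),
    (mc_theta (p ⊗ q) : S) *> p' = p <* (mc_phi (q ⊗ p') : T);
  mc_phiA : forall (q q' : mcQ) (p : mcP),
    q' <* (mc_theta (p ⊗ q) : S) = (mc_phi (q' ⊗ p) : T) *> q }.

Definition unitary_context S T (C : moritaContext S T) : Prop :=
  unitary (mcP C) /\ unitary (mcQ C).

Definition surjective_context S T (C : moritaContext S T) : Prop :=
  (forall s : S, exists x, mc_theta (m := C) x = s) /\
  (forall t : T, exists x, mc_phi (m := C) x = t).

Definition strongly_Morita_equivalent (S T : semigroupType) : Prop :=
  exists C : moritaContext S T, unitary_context C /\ surjective_context C.

Record actPair (S : semigroupType) := ActPair {
  pairA : leftAct S;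
  pairB : rightAct S;
  pairing : pairA -> pairB -> S;
  pairingMl : forall s a b, pairing (s *> a) b = s * pairing a b;
  pairingMr : forall a b s, pairing a (b <* s) = pairing a b * s }.

(* Vacuous when both acts are empty, and then [Sigma beta] is empty too.
   [semigroupType] allows the empty carrier, so the usual convention that
   semigroups are nonempty has to be stated as a hypothesis where it matters. *)
Definition dual_pair S (beta : actPair S) : Prop :=
  (forall a : pairA beta, exists a' : pairA beta,
     (exists s : S, a = s *> a') /\
     (forall s : S, exists b : pairB beta, pairing a' b = s)) /\
  (forall b : pairB beta, exists b' : pairB beta,
     (exists s : S, b = b' <* s) /\
     (forall s : S, exists a : pairA beta, pairing a b' = s)).

Section OmegaSigma.
Variables (S : semigroupType) (beta : actPair S).
Local Notation A := (pairA beta).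
Local Notation B := (pairB beta).
Local Notation "<< a , b >>" := (@pairing S beta a b).

Definition Omega_pred : pred ((A -> A) * (B -> B)) := fun x =>
  `[< [/\ left_morph x.1, right_morph x.2 &
          forall a b, << x.1 a, b >> = << a, x.2 b >>] >].

Record Omega := MkOmega {
  Omega_val :> (A -> A) * (B -> B);
  Omega_valP : Omega_pred Omega_val }.

HB.instance Definition _ := [isSub for Omega_val].
HB.instance Definition _ := [Choice of Omega by <:].

Lemma Omega_mul_subproof (x y : Omega) :
  Omega_pred (y.1 \o x.1, x.2 \o y.2).
Proof.
have /asboolP [x1 x2 xP] := Omega_valP x.
have /asboolP [y1 y2 yP] := Omega_valP y.
apply/asboolP; split=> [s a|b s|a b] /=; first by rewrite x1 y1.
  by rewrite y2 x2.
by rewrite yP xP.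
Qed.

(* (f, g)(f', g') = (f' f, g g'): left-act endomorphisms compose in the
   opposite order, as they act on the right of A. *)
Definition Omega_mul (x y : Omega) : Omega := MkOmega (Omega_mul_subproof x y).

Lemma Omega_mulA : associative Omega_mul.
Proof. by move=> x y z; apply: val_inj. Qed.

Lemma Omega_one_subproof : Omega_pred (idfun, idfun).
Proof. by apply/asboolP; split. Qed.

Definition Omega_one : Omega := MkOmega Omega_one_subproof.

Lemma Omega_mul1 : left_id Omega_one Omega_mul.
Proof. by case=> [[f g] ?]; apply: val_inj. Qed.

Lemma Omega_mulr1 : right_id Omega_one Omega_mul.
Proof. by case=> [[f g] ?]; apply: val_inj. Qed.

HB.instance Definition _ :=
  isMonoid.Build Omega Omega_mulA Omega_mul1 Omega_mulr1.

Definition Sigma_pred : pred Omega := fun x =>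
  `[< exists (b : B) (a : A),
        x.1 = (fun a' : A => << a', b >> *> a) /\
        x.2 = (fun b' : B => b <* << a, b' >>) >].

Lemma Sigma_mul_closed : mulg_closed Sigma_pred.
Proof.
move=> x y /asboolP [b [a [x1 x2]]] /asboolP [d [c [y1 y2]]].
apply/asboolP; exists b, (<< a, d >> *> c); split; apply: funext => z /=.
  by rewrite x1 y1 pairingMl lactA.
by rewrite x2 y2 pairingMl pairingMr.
Qed.

Record Sigma := MkSigma {
  Sigma_val :> Omega;
  Sigma_valP : Sigma_pred Sigma_val }.

HB.instance Definition _ := [isSub for Sigma_val].
HB.instance Definition _ := [Choice of Sigma by <:].
HB.instance Definition _ :=
  SubChoice_isSubSemigroup.Build Omega Sigma_pred Sigma Sigma_mul_closed.

End OmegaSigma.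

(* Main.v *)
Require Import Defs.
From mathcomp Require Import all_boot.
From mathcomp Require Import boolp.

(* Sigma acts on A on the right by a(rho, sigma) = rho a and on B on the left
   by (rho, sigma)b = sigma b; with these actions A and B are the two biacts of
   a Morita context, theta being the pairing and phi mapping b ⊗ a to the
   element (<-, b>a, b<a, ->) of Sigma.  Duality makes it unitary: if a = sa'
   with <a', B> = S, choose b with <a', b> = s, so that a = <a', b>a'
   = a'phi(b ⊗ a'); symmetrically for B. *)

Set Implicit Arguments.
Unset Strict Implicit.
Unset Printing Implicit Defensive.

Local Open Scope group_scope.
Local Open Scope act_scope.

Section RankOne.
Variables (S : semigroupType) (beta : actPair S).
Local Notation A := (pairA beta).
Local Notation B := (pairB beta).
Local Notation "<< a , b >>" := (@pairing S beta a b).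

Lemma rank1_Omega (b : B) (a : A) :
  Omega_pred (beta := beta) (fun a' => << a', b >> *> a,
                             fun b' => b <* << a, b' >>).
Proof.
apply/asboolP; split=> [s a'|b' s|a' b'] /=.
- by rewrite pairingMl lactA.
- by rewrite pairingMr ractA.
- by rewrite pairingMl pairingMr.
Qed.

Lemma rank1_Sigma (b : B) (a : A) : Sigma_pred (MkOmega (rank1_Omega b a)).
Proof. by apply/asboolP; exists b, a. Qed.

(** The analogue of a rank-one operator together with its adjoint. *)
Definition rank1 (b : B) (a : A) : Sigma beta := MkSigma (rank1_Sigma b a).

(** [Sigma] is a subtype of the subtype [Omega], so two uses of [val_inj] reduce equality to the
    underlying pairs of maps. *)
Lemma Sigma_ext (x y : Sigma beta) :
  (Sigma_val x).1 =1 (Sigma_val y).1 -> (Sigma_val x).2 =1 (Sigma_val y).2 ->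
  x = y.
Proof.
move=> /funext xy1 /funext xy2; do 2!apply: val_inj => /=.
by rewrite [LHS]surjective_pairing xy1 xy2 -surjective_pairing.
Qed.

Lemma rank1_surj (x : Sigma beta) : exists b a, x = rank1 b a.
Proof.
have /asboolP [b [a [x1 x2]]] := Sigma_valP x.
by exists b, a; apply: Sigma_ext => z /=; rewrite ?x1 ?x2.
Qed.

Lemma Sigma_adj (x : Sigma beta) a b :
  << (Sigma_val x).1 a, b >> = << a, (Sigma_val x).2 b >>.
Proof. by have /asboolP [_ _] := Omega_valP (Sigma_val x). Qed.

Lemma Sigma_left_morph (x : Sigma beta) : left_morph (Sigma_val x).1.
Proof. by have /asboolP [] := Omega_valP (Sigma_val x). Qed.

Lemma Sigma_right_morph (x : Sigma beta) : right_morph (Sigma_val x).2.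
Proof. by have /asboolP [] := Omega_valP (Sigma_val x). Qed.

(** This is what lets [rank1] descend to the tensor product of B and A over S. *)
Lemma rank1_balanced b s a : rank1 (b <* s) a = rank1 b (s *> a).
Proof.
apply: Sigma_ext => z /=; first by rewrite pairingMr lactA.
by rewrite pairingMl ractA.
Qed.

(** Adjointness gives the equality on A, and right linearity of the second component of [x] gives it
    on B. With its mirror image [rank1_mul], this makes [Sigma_phi] a biact morphism. *)
Lemma mul_rank1 (x : Sigma beta) b a :
  x * rank1 b a = rank1 ((Sigma_val x).2 b) a.
Proof.
by apply: Sigma_ext => z /=; rewrite ?Sigma_adj // Sigma_right_morph.
Qed.

Lemma rank1_mul b a (x : Sigma beta) :
  rank1 b a * x = rank1 b ((Sigma_val x).1 a).
Proof.
by apply: Sigma_ext => z /=; rewrite ?Sigma_adj // Sigma_left_morph.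
Qed.

End RankOne.

Section SigmaContext.
Variables (S T : semigroupType) (beta : actPair S).
Variables (f : {multiplicative T -> Sigma beta}) (g : Sigma beta -> T).
Hypotheses (fK : cancel f g) (gK : cancel g f).
Local Notation A := (pairA beta).
Local Notation B := (pairB beta).
Local Notation "<< a , b >>" := (@pairing S beta a b).

(** A right action, because the product of [Omega] composes first components in the opposite
    order. *)
Definition Sigma_ract (a : A) (t : T) : A := (Sigma_val (f t)).1 a.
Definition Sigma_lact (t : T) (b : B) : B := (Sigma_val (f t)).2 b.

Lemma Sigma_ractA a s t : Sigma_ract a (s * t) = Sigma_ract (Sigma_ract a s) t.
Proof. by rewrite /Sigma_ract gmulfM. Qed.

Lemma Sigma_lactA s t b : Sigma_lact (s * t) b = Sigma_lact s (Sigma_lact t b).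
Proof. by rewrite /Sigma_lact gmulfM. Qed.

Lemma Sigma_ract_assoc s a t : Sigma_ract (s *> a) t = s *> Sigma_ract a t.
Proof. exact: Sigma_left_morph. Qed.

Lemma Sigma_lact_assoc t b s : Sigma_lact t b <* s = Sigma_lact t (b <* s).
Proof. by rewrite /Sigma_lact Sigma_right_morph. Qed.

Definition SigmaP : biact S T := Biact Sigma_ractA Sigma_ract_assoc.
Definition SigmaQ : biact T S :=
  @Biact T S (LeftAct _ Sigma_lactA) _ (@ractA S B) Sigma_lact_assoc.

Definition Sigma_theta : tensor_biact SigmaP SigmaQ -> regular_biact S :=
  tensor_lift (A := SigmaP) (B := SigmaQ) (@pairing S beta).
Definition Sigma_phi : tensor_biact SigmaQ SigmaP -> regular_biact T :=
  tensor_lift (A := SigmaQ) (B := SigmaP) (fun b a => g (rank1 b a)).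

(** The pairing is balanced over T exactly because the two components of an element of [Omega] are
    adjoint. *)
Lemma Sigma_thetaE (a : SigmaP) (b : SigmaQ) :
  Sigma_theta (a ⊗ b) = << a, b >>.
Proof. by apply: tensor_liftE => a' t b'; apply: Sigma_adj. Qed.

Lemma Sigma_phiE (b : SigmaQ) (a : SigmaP) :
  Sigma_phi (b ⊗ a) = g (rank1 b a).
Proof.
apply: (tensor_liftE (A := SigmaQ) (B := SigmaP)) => b' s a'.
by rewrite rank1_balanced.
Qed.

Lemma Sigma_theta_morph : biact_morph Sigma_theta.
Proof.
split=> [s x|x s]; have [a [b ->]] := tens_surj x => /=.
  by rewrite tensor_lactE !Sigma_thetaE pairingMl.
by rewrite tensor_ractE !Sigma_thetaE pairingMr.
Qed.

Lemma Sigma_phi_morph : biact_morph Sigma_phi.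
Proof.
split=> [t x|x t]; have [b [a ->]] := tens_surj x => /=.
  (* The inverse [g] is only given as a map, so the equation is pushed through the injective
     morphism [f] and checked in [Sigma]. *)
  rewrite tensor_lactE !Sigma_phiE; apply: (can_inj fK).
  by rewrite gmulfM !gK mul_rank1.
rewrite tensor_ractE !Sigma_phiE; apply: (can_inj fK).
by rewrite gmulfM !gK rank1_mul.
Qed.

(** Once [f] cancels [g], the right side is the first component of [rank1 q p'] at [p], which is the
    left side by definition. *)
Lemma Sigma_thetaA (p p' : SigmaP) (q : SigmaQ) :
  (Sigma_theta (p ⊗ q) : S) *> p' = p <* (Sigma_phi (q ⊗ p') : T).
Proof. by rewrite Sigma_thetaE Sigma_phiE /= /Sigma_ract gK. Qed.

Lemma Sigma_phiA (q q' : SigmaQ) (p : SigmaP) :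
  q' <* (Sigma_theta (p ⊗ q) : S) = (Sigma_phi (q' ⊗ p) : T) *> q.
Proof. by rewrite Sigma_thetaE Sigma_phiE /= /Sigma_lact gK. Qed.

Definition Sigma_context : moritaContext S T :=
  MoritaContext Sigma_theta_morph Sigma_phi_morph Sigma_thetaA Sigma_phiA.

Hypothesis beta_dual : dual_pair beta.

Lemma Sigma_context_unitary : unitary_context Sigma_context.
Proof.
have [dualA dualB] := beta_dual.
split; split=> [x|x] /=.
- by have [a [[s ->] _]] := dualA x; exists s, a.
- have [a [[s ->] /(_ s) [b ab]]] := dualA x.
  by exists a, (g (rank1 b a)); rewrite /Sigma_ract gK /= ab.
- have [b [[s ->] /(_ s) [a ab]]] := dualB x.
  by exists (g (rank1 b a)), b; rewrite /Sigma_lact gK /= ab.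
- by have [b [[s ->] _]] := dualB x; exists b, s.
Qed.

Lemma Sigma_context_surjective :
  inhabited (Sigma beta) -> surjective_context Sigma_context.
Proof.
move=> [x]; split=> [s|t] /=.
  (* Duality says nothing when A is empty; the given element of [Sigma] supplies a point of A to
     which it applies. *)
  have [_ [a _]] := rank1_surj x.
  have [a' [_ /(_ s) [b ab]]] := beta_dual.1 a.
  by exists (tens (A := SigmaP) (B := SigmaQ) a' b); rewrite Sigma_thetaE.
(* Surjectivity of [Sigma_phi] holds because every element of [Sigma] has rank one. *)
have [b [a fE]] := rank1_surj (f t).
exists (tens (A := SigmaQ) (B := SigmaP) b a).
by rewrite Sigma_phiE -fE fK.
Qed.

End SigmaContext.

Theorem corollary3p9 (S T : semigroupType)
    (S_nonempty : inhabited S) (T_nonempty : inhabited T)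
    (S_wlu : weak_local_units S) (T_wlu : weak_local_units T)
    (T_Sigma : exists beta : actPair S,
       dual_pair beta /\ semigroup_isomorphic T (Sigma beta)) :
  strongly_Morita_equivalent S T.
Proof.
have [beta [beta_dual [f [g fK gK]]]] := T_Sigma.
exists (Sigma_context fK gK); split; first exact: Sigma_context_unitary.
have [t] := T_nonempty; apply: Sigma_context_surjective => //.
by split; exact: f t.
Qed.
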